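(* Let $G$ be a non-supersolvable finite group of order $n$ such that $\psi(G)=\frac{31}{77}\psi(C_n)$. Then $G\cong A_4\times C_m$ for some positive integer $m$ with $\gcd(6,m)=1$.
   Context: All groups are finite. For a finite group $G$, $\psi(G)=\sum_{g\in G} o(g)$, where $o(g)$ is the order of $g$. $C_n$ denotes the cyclic group of order $n$; $A_4$ is the alternating group of degree 4. *)

(* Defs.v *)
From HB Require Import structures.
From mathcomp Require Import all_boot all_fingroup all_algebra all_solvable.
Set Implicit Arguments. Unset Strict Implicit. Unset Printing Implicit Defensive.
Open Scope group_scope.

Definition psi (gT : finGroupType) (G : {set gT}) : nat := (\sum_(g in G) #[g])%N.

Definition psiC (n : nat) : nat := psi (Zp n).

Definition supersolvable (gT : finGroupType) (G : {group gT}) : Prop :=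
  exists s : seq {group gT},
    [/\ head 1%G s = 1%G, last 1%G s = G,
        forall H, H \in s -> H <| G &
        path (fun H K : {group gT} => (H <| K) && cyclic (K / H)) 1%G s].

(* Main.v *)
Require Import Defs.
From HB Require Import structures.
From mathcomp Require Import all_boot all_fingroup all_algebra all_solvable.
From mathcomp Require Import zify.
Set Implicit Arguments. Unset Strict Implicit. Unset Printing Implicit Defensive.

(* Write n for the order of G.  Some <x> = H has index at most n^2 / psi(G), and
   psi(C_n) / n^2 is at least the product of q / (q + 1) over the primes q
   dividing n.  Let p be the largest of them.  If p >= 7 the index is less than
   p; if p = 5 it is at most 5; if p <= 3 it is at most 4.
   - Index less than p: the Sylow p-subgroup P is cyclic and normal, and
     psi(G) <= psi(P) psi(G / P), with equality only for P central.  Induction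
     applies to G / P.
   - Prime index: H meets a conjugate in a central subgroup K with
     |H : K| < |G : H|, so the Sylow |G : H|-subgroup of G / K is normal with
     cyclic quotient and G is supersolvable.
   - Index 4, p <= 3: H is the normaliser of a Sylow 3-subgroup, and all
     intersections of two distinct conjugates of H are equal to one central
     subgroup K of index 3 in H.  The conjugates of H \ K cover G except for
     V = Q x K_3, where Q is a Sylow 2-subgroup, which is not cyclic.  Summing
     orders gives psi(G) <= 31/77 psi(C_n), with equality only if K = 1, and
     then G acts on the cosets of H as the alternating group. *)

(** * Order sums of cyclic groups and coprime direct products *)

Lemma psi_isog (aT rT : finGroupType) (G : {group aT}) (H : {group rT}) :
  G \isog H -> psi G = psi H.
Proof.
case/isogP=> f injf <-; rewrite /psi morphimEdom big_imset /=; last exact/injmP.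
by apply: eq_bigr => x Gx; rewrite order_injm.
Qed.

Lemma psi_cyclic (gT : finGroupType) (G : {group gT}) :
  cyclic G -> psi G = psiC #|G|.
Proof.
case/cyclicP=> x defG; rewrite /psiC defG -orderE.
by apply/esym/(@psi_isog _ _ (Zp_group #[x]) <[x]>%G)/Zp_isog.
Qed.

Lemma cyclic_Zp (n : nat) : cyclic (Zp n).
Proof.
rewrite /Zp; case: ifP => [lt1n|_]; last exact: cyclic1.
by apply/cyclicP; exists Zp1; rewrite /= Zp_cycle.
Qed.

Lemma psi_dprod (gT : finGroupType) (A B G : {group gT}) :
  A \x B = G -> coprime #|A| #|B| -> psi G = (psi A * psi B)%N.
Proof.
case/dprodP=> _ defG cAB tiAB coAB; rewrite /psi big_distrlr /= -defG.
rewrite pair_big_dep /= -[A * B]/(A * B)%g.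
have ->: (A * B)%g = [set p.1 * p.2 | p in [pred p | (p.1 \in A) && (p.2 \in B)]].
  apply/setP=> x; apply/mulsgP/imsetP=> [[a b Aa Bb ->]|[[a b]]].
    by exists (a, b); rewrite ?inE ?Aa.
  by rewrite inE => /andP[/= Aa Bb] ->; exists a b.
rewrite big_imset /=.
  apply: eq_bigr => -[a b] /andP[/= Aa Bb]; apply: orderM.
    by apply/esym; apply: (centsP cAB).
  exact: coprime_dvdl (order_dvdG Aa) (coprime_dvdr (order_dvdG Bb) coAB).
move=> [a b] [c d]; rewrite !inE /= => /andP[Aa Bb] /andP[Ac Bd] eq_ab.
have eqca: c^-1 * a = d * b^-1.
  by apply: (mulgI c); rewrite mulKVg; apply: (mulIg b); rewrite -mulgA mulgKV.
have: c^-1 * a \in A :&: B.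
  by rewrite inE groupM ?groupV //= eqca groupM ?groupV.
rewrite tiAB => /set1gP e1; congr (_, _).
  by apply: (mulgI c^-1); rewrite e1 mulVg.
by apply: (mulIg b^-1); rewrite -eqca e1 mulgV.
Qed.

Lemma isog_setXg1 (aT rT : finGroupType) (G : {group aT}) :
  G \isog setX G (1 : {set rT}).
Proof. by rewrite -morphim_pairg1 sub_isog ?subsetT ?injm_pairg1. Qed.

Lemma isog_setX1g (aT rT : finGroupType) (G : {group rT}) :
  G \isog setX (1 : {set aT}) G.
Proof. by rewrite -morphim_pair1g sub_isog ?subsetT ?injm_pair1g. Qed.

Lemma psiC_mul (m n : nat) :
  (0 < m)%N -> (0 < n)%N -> coprime m n -> psiC (m * n) = (psiC m * psiC n)%N.
Proof.
move=> m0 n0 co_mn.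
have dG := setX_dprod (Zp_group m) (Zp_group n).
have isoL: Zp m \isog setX (Zp m) (1 : {set 'Z_n}) by exact: isog_setXg1.
have isoR: Zp n \isog setX (1 : {set 'Z_m}) (Zp n) by exact: isog_setX1g.
have cL := card_isog isoL; have cR := card_isog isoR.
rewrite !card_Zp // in cL cR.
have cyc: cyclic (setX (Zp m) (Zp n)).
  rewrite (cyclic_dprod dG) -?cL -?cR //.
    by rewrite -(isog_cyclic isoL) cyclic_Zp.
  by rewrite -(isog_cyclic isoR) cyclic_Zp.
have:= psi_dprod dG; rewrite /= -cL -cR => /(_ co_mn).
rewrite (psi_cyclic cyc) cardsX !card_Zp // => ->.
by rewrite -(psi_isog isoL) -(psi_isog isoR).
Qed.

Lemma psiC1 : psiC 1 = 1%N.
Proof. by rewrite /psiC /psi /Zp /= big_set1 order1. Qed.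

(** The elements outside the subgroup of index p are generators. *)
Lemma psiC_primeS (p a : nat) : prime p ->
  psiC (p ^ a.+1) = (psiC (p ^ a) + p ^ a.+1 * (p ^ a.+1 - p ^ a))%N.
Proof.
move=> p_pr; have p_gt0 := prime_gt0 p_pr.
have pa0: (0 < p ^ a.+1)%N by rewrite expn_gt0 p_gt0.
have oG := card_Zp pa0.
have [x defG] := cyclicP (cyclic_Zp (p ^ a.+1)).
have ox: #[x] = (p ^ a.+1)%N by rewrite orderE -defG.
have sMG: <[x ^+ p]> \subset Zp (p ^ a.+1) by rewrite defG cycleX.
have oM: #|<[x ^+ p]>| = (p ^ a)%N.
  by rewrite -orderE orderXdiv ox expnS ?dvdn_mulr // mulKn.
rewrite {1}/psiC /psi (big_setID <[x ^+ p]>) /= (setIidPr sMG).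
congr (_ + _)%N.
  by have := psi_cyclic (cycle_cyclic (x ^+ p)); rewrite oM.
have <-: #|Zp (p ^ a.+1) :\: <[x ^+ p]>| = (p ^ a.+1 - p ^ a)%N.
  by rewrite cardsD (setIidPr sMG) oM oG.
rewrite mulnC -sum_nat_const; apply: eq_bigr => y /setDP[Gy nMy].
have := order_dvdG Gy; rewrite oG => /(dvdn_pfactor _ _ p_pr)[b].
rewrite leq_eqVlt => /predU1P[-> -> //|lt_ba oy].
case/negP: nMy; rewrite -cycle_subG.
rewrite -(cardSg_cyclic (cyclic_Zp (p ^ a.+1))) ?(sMG, cycle_subG) //.
by rewrite oM -orderE oy dvdn_exp2l.
Qed.

(** The increments in [psiC_primeS] form a geometric series; the factor p + 1 stays on the left to
    avoid a division. *)
Lemma psiC_prime_pow (p a : nat) : prime p ->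
  (p.+1 * psiC (p ^ a) = p ^ (a.*2).+1 + 1)%N.
Proof.
move=> p_pr; elim: a => [|a IHa].
  by rewrite expn0 psiC1 muln1 expn1 addn1.
rewrite psiC_primeS // mulnDr IHa doubleS !expnS -addnn expnD.
have := prime_gt0 p_pr; have: (0 < p ^ a)%N by rewrite expn_gt0 prime_gt0.
by move: (p ^ a)%N => q; case: p {p_pr IHa} => // p; nia.
Qed.

(** * Normal cyclic Sylow subgroups *)

(** Coprime action on the abelian group P makes [[~: P, A]] and ['C_P(A)] meet trivially. Subgroups
    of a cyclic p-group form a chain, so one of the two is trivial. *)
Lemma cyclic_pgroup_coprime_cent (gT : finGroupType) (p : nat) (P A : {group gT}) :
  p.-group P -> cyclic P -> A \subset 'N(P) -> coprime #|P| #|A| ->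
  A \subset 'C(P) \/ 'C_P(A) = 1.
Proof.
move=> pP cycP nPA coPA; have abP := cyclic_abelian cycP.
have tiRC: [~: P, A] :&: 'C_P(A) = 1.
  apply/trivgP/subsetP=> x /setIP[Rx /setIP[_ cAx]].
  by rewrite -(coprime_abel_cent_TI nPA coPA abP) inE Rx.
have sRP: [~: P, A] \subset P by rewrite commg_subl.
have sCP: 'C_P(A) \subset P by apply: subsetIl.
have [m oR] := p_natP (pgroupS sRP pP); have [n oC] := p_natP (pgroupS sCP pP).
have [le_mn|le_nm] := leqP m n.
  left; have: [~: P, A] \subset 'C_P(A).
    by rewrite -(cardSg_cyclic cycP) // oR oC dvdn_exp2l.
  by move/setIidPl; rewrite tiRC centsC => /esym/commG1P.
right; have: 'C_P(A) \subset [~: P, A].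
  by rewrite -(cardSg_cyclic cycP) // oR oC dvdn_exp2l // ltnW.
by move/setIidPr; rewrite tiRC.
Qed.

Section NormalCyclicSylow.

Variables (gT : finGroupType) (p : nat) (G P : {group gT}).
Hypotheses (sylP : p.-Sylow(G) P) (nsPG : P <| G) (cycP : cyclic P).

Let sPG : P \subset G := normal_sub nsPG.
Let nPG : G \subset 'N(P) := normal_norm nsPG.
Let pP : p.-group P := pHall_pgroup sylP.
Let abP : abelian P := cyclic_abelian cycP.

Lemma Sylow_constt_in (g : gT) : g \in G -> g.`_p \in P.
Proof.
move=> Gg; rewrite (mem_normal_Hall sylP nsPG) ?p_elt_constt //.
by rewrite groupX.
Qed.

Lemma coset_constt (g : gT) : g \in G -> coset P g = coset P g.`_p^'.
Proof.
move=> Gg; rewrite -{1}(consttC p g) coset_kerl //; exact: Sylow_constt_in.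
Qed.

(** The p'-part of g represents the same coset as g, and its cycle meets P trivially, so it keeps
    its order in G / P. *)
Lemma order_coset_Sylow (g : gT) :
  g \in G -> #[g] = (#[g.`_p] * #[coset P g])%N.
Proof.
move=> Gg; rewrite coset_constt // -{1}(consttC p g).
have Ggp: g.`_p^' \in G by rewrite groupX.
have ->: #[coset P g.`_p^'] = #[g.`_p^'].
  have nPg: <[g.`_p^']> \subset 'N(P) by rewrite cycle_subG (subsetP nPG).
  have ti: P :&: <[g.`_p^']> = 1.
    by apply: coprime_TIg; apply: pnat_coprime pP _; apply: p_elt_constt.
  have := card_isog (quotient_isog nPg ti).
  by rewrite /= quotient_cycle ?(subsetP nPg) ?cycle_id // => <-.
apply: orderM; first by rewrite /commute -!expgnDr -?expgD addnC.
exact: pnat_coprime (p_elt_constt _ _) (p_elt_constt _ _).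
Qed.

Lemma psi_coset_Sylow :
  psi G = (\sum_(c in G / P) #[c] * \sum_(g in G | coset P g == c) #[g.`_p])%N.
Proof.
rewrite /psi (partition_big (coset P) (mem (G / P))) /= => [|g Gg]; last first.
  by rewrite mem_quotient.
apply: eq_bigr => c _; rewrite big_distrr; apply: eq_bigr => g /= /andP[Gg /eqP <-].
by rewrite mulnC -order_coset_Sylow.
Qed.

(* A p'-element l either centralises the cyclic group P, so that g.`_p runs over
   P as g runs over the coset of l, or has 'C_P(l) = 1, so that every g.`_p is 1. *)
Lemma sum_constt_coset (l : gT) : l \in G ->
  (\sum_(g in G | coset P g == coset P l) #[g.`_p] <= psi P ?= iff (l \in 'C(P)))%N.
Proof.
move=> Gl.
wlog p'l: l Gl / p^'.-elt l.
  move=> IH; have Gl1: l.`_p^' \in G by rewrite groupX.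
  have:= IH _ Gl1 (p_elt_constt _ _); rewrite -coset_constt //.
  suff ->: (l.`_p^' \in 'C(P)) = (l \in 'C(P)) by [].
  rewrite -{2}(consttC p l) groupMl //.
  by rewrite (subsetP (abP : P \subset 'C(P))) ?Sylow_constt_in.
have nPl: l \in 'N(P) := subsetP nPG _ Gl.
have reidx (F : gT -> nat) :
    (\sum_(g in G | coset P g == coset P l) F g = \sum_(x in P) F (l * x)%g)%N.
  rewrite (reindex_inj (mulgI l)) /=; apply: eq_bigl => x.
  apply/andP/idP=> [[Glx eq_lx]|Px]; last first.
    by rewrite coset_kerr // groupM // (subsetP sPG).
  have Gx: x \in G by rewrite -(groupMl x Gl).
  have nPx := subsetP nPG _ Gx.
  apply: coset_idr => //; apply: (mulgI (coset P l)).
  by rewrite mulg1 -morphM //; apply/eqP.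
rewrite reidx; have [cPl|ncPl] := boolP (l \in 'C(P)).
  suff ->: (\sum_(x in P) #[(l * x).`_p] = psi P)%N by apply/leqif_refl.
  apply: eq_bigr => x Px.
  have cxl: commute l x by apply: (centP cPl).
  rewrite consttM // (constt1P p'l) mul1g constt_p_elt //.
  exact: mem_p_elt pP Px.
have nPA: <[l]> \subset 'N(P) by rewrite cycle_subG.
have coPl: coprime #|P| #|<[l]>| by apply: pnat_coprime pP _.
have [cPA|tiC] := cyclic_pgroup_coprime_cent pP cycP nPA coPl.
  by rewrite -cycle_subG cPA in ncPl.
(* A non-trivial element of P makes the final comparison of a sum of ones with [psi P] strict. *)
have [x Px ntx]: exists2 x, x \in P & x != 1.
  apply/trivgPn; apply: contraNneq ncPl => ->; apply/centP=> y /set1P->.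
  exact: commute1.
have eq1: (\sum_(x in P) #[(l * x).`_p] = \sum_(x in P) 1)%N.
  apply: eq_bigr => {ntx Px}x Px; suff ->: (l * x).`_p = 1 by rewrite order1.
  have Glx: l * x \in G by rewrite groupM // (subsetP sPG).
  (* This p-part commutes with l x, being a power of it, and with x, as P is abelian; hence it
     commutes with l. *)
  suff: (l * x).`_p \in 'C_P(<[l]>) by rewrite tiC => /set1P.
  rewrite inE Sylow_constt_in //= cent_cycle.
  apply/cent1P; have cx: commute (l * x).`_p (l * x) by apply/esym/commuteX.
  have cxx: commute (l * x).`_p x by apply: (centsP abP); rewrite ?Sylow_constt_in.
  by have:= commuteM cx (commuteV cxx); rewrite mulgK.
rewrite eq1; apply/leqifP; rewrite /psi (bigD1 x) // [ltnRHS](bigD1 x) //=.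
rewrite -addSn leq_add ?order_gt1 //.
by apply: leq_sum => y _; rewrite order_gt0.
Qed.

(** This is [sum_constt_coset] summed over G / P. In case of equality every coset of P comes from
    ['C_G(P)], which contains the abelian group P. *)
Lemma psi_normal_cyclic_Sylow :
  (psi G <= psi P * psi (G / P) ?= iff (G \subset 'C(P)))%N.
Proof.
rewrite psi_coset_Sylow {2}/psi big_distrr /=.
have step (c : coset_of P) : c \in G / P ->
    (#[c] * \sum_(g in G | coset P g == c) #[g.`_p] <= psi P * #[c]
       ?= iff (c \in 'C_G(P) / P))%N.
  case/morphimP=> l nPl Gl ->; have [le_l eq_l] := sum_constt_coset Gl.
  split; first by rewrite mulnC leq_mul2r le_l orbT.
  rewrite mulnC eqn_mul2r eqn0Ngt order_gt0 /= eq_l.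
  apply/idP/idP=> [cPl|/morphimP[k nPk /setIP[Gk cPk] /= eqlk]].
    by apply: mem_quotient; rewrite inE Gl.
  have: l \in P :* k by apply/rcoset_kercosetP.
  by case/rcosetP=> x Px ->; rewrite groupM // (subsetP abP).
have := leqif_sum step; rewrite /=.
suff ->: [forall (c | c \in G / P), c \in 'C_G(P) / P] = (G \subset 'C(P)) by [].
apply/forall_inP/idP=> [all_c | cGP c].
  have sP: P \subset 'C_G(P) by rewrite subsetI sPG.
  have: G / P \subset 'C_G(P) / P by apply/subsetP.
  by rewrite quotientSGK // => /subset_trans->; rewrite ?subsetIr.
by rewrite (setIidPl cGP).
Qed.

End NormalCyclicSylow.

(** * Criteria for supersolvability *)

Lemma supersolvable_cyclic (gT : finGroupType) (G : {group gT}) :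
  cyclic G -> supersolvable G.
Proof.
move=> cycG; exists [:: 1%G; G]; split=> //= [H|].
  by rewrite !inE => /orP[] /eqP->; rewrite ?normal1 ?normal_refl.
by rewrite normal_refl normal1 !quotient_cyclic ?cyclic1.
Qed.

(** The preimage of the trivial group is K, so the lifted series continues 1 <= K. A repeated term
    is harmless, its quotient being trivial. *)
Lemma supersolvable_quotient_cyclic (gT : finGroupType) (G K : {group gT}) :
  K <| G -> cyclic K -> supersolvable (G / K)%G -> supersolvable G.
Proof.
move=> nsKG cycK [s [_ lastS nsS pathS]].
pose f (H : {group coset_of K}) : {group gT} := (coset K @*^-1 H)%G.
have f1: f 1%G = K by apply: val_inj; rewrite /= cosetpre1 // -trivg_quotient quotientGK.
exists (1%G :: K :: map f s); split=> //=.
- have ->: last K (map f s) = f (last 1%G s) by rewrite -(last_map f) f1.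
  by apply: val_inj; rewrite /= lastS /= quotientGK.
- move=> H; rewrite !inE => /or3P[/eqP->|/eqP->//|/mapP[L sL ->]].
    exact: normal1.
  by rewrite -(quotientGK nsKG) /= cosetpre_normal nsS.
rewrite normal_refl normal1 !quotient_cyclic ?cyclic1 //=.
suff: path (fun H L : {group gT} => (H <| L) && cyclic (L / H)) (f 1%G) (map f s).
  by rewrite f1.
rewrite path_map; apply: sub_path pathS => H L /andP[nsHL cycLH] /=.
rewrite cosetpre_normal nsHL /=.
have sK (M : {group coset_of K}) : K \subset f M by apply: sub_cosetpre.
have nK (M : {group coset_of K}) : K <| f M.
  by rewrite /normal sK subsetIl.
have nsf: f H <| f L by rewrite cosetpre_normal.
rewrite -(isog_cyclic (third_isog (sK H) (nK L) nsf)) /=.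
by rewrite !cosetpreK.
Qed.

Lemma supersolvable_pgroup (p : nat) (gT : finGroupType) (G : {group gT}) :
  p.-group G -> supersolvable G.
Proof.
have [n] := ubnP #|G|; elim: n gT G => // n IHn gT G leGn pG.
have [Z1|ntZ] := eqVneq 'Z(G) 1.
  have /group_inj->: G :=: 1%G by apply: trivg_center_pgroup pG Z1.
  exact/supersolvable_cyclic/cyclic1.
have [z Zz ntz] := trivgPn _ ntZ.
have nsZ: <[z]> <| G by apply: sub_center_normal; rewrite cycle_subG.
apply: (supersolvable_quotient_cyclic nsZ (cycle_cyclic z)).
apply: IHn; last exact: quotient_pgroup.
rewrite -ltnS (leq_trans _ leGn) // ltnS ltn_quotient ?normal_sub //.
by rewrite cycle_eq1.
Qed.

(** The index of the normaliser counts the Sylow p-subgroups, so it is 1 modulo p. *)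
Lemma Sylow_normal_index (p : nat) (gT : finGroupType) (G P : {group gT}) :
  prime p -> p.-Sylow(G) P -> (#|G : 'N_G(P)| < p)%N -> P <| G.
Proof.
move=> p_pr sylP lt_p; have:= card_Syl_mod G p_pr.
rewrite (card_Syl sylP) modn_small // => /eqP.
rewrite indexg_eq1 subsetI subxx => nPG.
by rewrite /normal (pHall_sub sylP).
Qed.

(** Cancelling in g = h (g^-1 k g), with h and k in H, gives g = k h. So for g outside H the product
    is never all of G. *)
Lemma mulg_conj_neq (gT : finGroupType) (G H : {group gT}) (g : gT) :
  H \subset G -> g \in G -> H * H :^ g = G -> g \in H.
Proof.
move=> sHG Gg defG; have: g \in H * H :^ g by rewrite defG.
case/mulsgP=> h _ Hh /imsetP[k Hk ->]; rewrite conjgE !mulgA => def_g.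
have e1: h * g^-1 * k = 1 by apply: (mulIg g); rewrite mul1g.
have ->: g = k * h.
  apply: (mulgI (h * g^-1)); rewrite mulgKV mulgA e1 mul1g //.
by rewrite groupM.
Qed.

Lemma card_mulg_conj (gT : finGroupType) (H : {group gT}) (g : gT) :
  #|H * H :^ g| = (#|H| * #|H : H :&: H :^ g|)%N.
Proof.
apply/eqP; rewrite -(eqn_pmul2r (cardG_gt0 (H :&: H :^ g)%G)) -mulnA.
by rewrite [(#|_ : _| * _)%N]mulnC Lagrange ?subsetIl // -mul_cardG cardJg.
Qed.

Lemma cyclic_conjI_cent (gT : finGroupType) (H : {group gT}) (g : gT) :
  cyclic H -> H * H :^ g \subset 'C(H :&: H :^ g).
Proof.
move/cyclic_abelian=> abH; have abHg: abelian (H :^ g) by rewrite abelianJ.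
apply: mul_subG; first exact: subset_trans abH (centS (subsetIl _ _)).
exact: subset_trans abHg (centS (subsetIr _ _)).
Qed.

Lemma supersolvable_cyclic_prime_index (gT : finGroupType) (G H : {group gT}) :
  H \subset G -> cyclic H -> prime #|G : H| -> supersolvable G.
Proof.
move=> sHG cycH q_pr; set q := #|G : H| in q_pr.
have [nHG|] := boolP (G \subset 'N(H)).
  have nsHG: H <| G by rewrite /normal sHG.
  apply: (supersolvable_quotient_cyclic nsHG cycH); apply: supersolvable_cyclic.
  by apply: prime_cyclic; rewrite card_quotient.
(* H is maximal, so H and H :^ g generate G and their intersection K is central;
   as H * H :^ g is not G, the index of K in H is less than q. *)
case/subsetPn=> g Gg nHg; pose K := (H :&: H :^ g)%G.
have sHgG: H :^ g \subset G by rewrite -(conjGid Gg) conjSg.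
have sKH: K \subset H by apply: subsetIl.
have sKG: K \subset G := subset_trans sKH sHG.
have cKG: G \subset 'C(K).
  have sHHC: H * H :^ g \subset 'C_G(K).
    by rewrite subsetI mul_subG ?cyclic_conjI_cent.
  have sHC: H \subset 'C_G(K) := subset_trans (mulG_subl _ _) sHHC.
  have sHgC: H :^ g \subset 'C_G(K) := subset_trans (mulG_subr _ _) sHHC.
  have /maxgroupP[_ maxH] := p_index_maximal sHG q_pr.
  apply/setIidPl/eqP; rewrite eqEproper subsetIl /=; apply/negP => ltCG.
  case/negP: nHg; rewrite inE.
  by move: sHgC; have /= -> := maxH _ ltCG sHC.
have nsKG: K <| G by rewrite /normal sKG cents_norm.
set j := #|H : K|.
have oGK: #|G / K| = (q * j)%N.
  by rewrite card_quotient ?normal_norm // -(Lagrange_index sHG sKH).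
have j_gt0: (0 < j)%N := indexg_gt0 _ _.
have lt_jq: (j < q)%N.
  rewrite -(ltn_pmul2l (cardG_gt0 H)) Lagrange // -(card_mulg_conj H g).
  rewrite ltn_neqAle subset_leq_card ?mul_subG // andbT.
  apply: contra nHg => /eqP eq_c; rewrite (subsetP (normG H)) //.
  apply: (mulg_conj_neq sHG Gg); apply/eqP.
  by rewrite eqEcard mul_subG //= eq_c.
(* As j < q, a Sylow q-subgroup of G / K has order q and index j, which is below q. *)
have co_qj: coprime q j by rewrite prime_coprime // gtnNdvd.
apply: (supersolvable_quotient_cyclic nsKG (cyclicS sKH cycH)).
have [S sylS] := Sylow_exists q (G / K)%G.
have oS: #|S| = q.
  rewrite (card_Hall sylS) /= oGK partnM ?(prime_gt0 q_pr) // part_pnat_id ?pnat_id //.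
  by rewrite part_p'nat ?muln1 // p'natE // gtnNdvd.
have iS: #|G / K : S| = j.
  apply/eqP; rewrite -(eqn_pmul2l (cardG_gt0 S)) Lagrange ?(pHall_sub sylS) //.
  by rewrite oS /= oGK.
have nsS: S <| (G / K)%G.
  apply: (Sylow_normal_index q_pr sylS); apply: leq_ltn_trans lt_jq.
  rewrite -iS dvdn_leq ?indexg_gt0 // indexgS //.
  by rewrite subsetI (pHall_sub sylS) normG.
apply: (supersolvable_quotient_cyclic nsS); first by rewrite prime_cyclic ?oS.
have oHK: #|H / K| = j.
  by rewrite card_quotient // (subset_trans sHG) ?normal_norm.
(* Hence the quotient of G / K by S is an image of the cyclic group H. *)
have defGK: S * (H / K) = G / K.
  apply/eqP; rewrite eqEcard mul_subG ?(pHall_sub sylS) ?quotientS //=.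
  by rewrite TI_cardMg ?oS ?oHK ?oGK // coprime_TIg // oS /= oHK.
apply: supersolvable_cyclic; rewrite /= -defGK quotientMidl.
by rewrite !quotient_cyclic.
Qed.

(** * Lower bounds for psi(C_n) and the index of a cyclic subgroup *)

(** The pair c, d stands for the fraction c / d bounding psi(C_n) / n^2 from below, with
    denominators cleared to stay in [nat]. *)
Definition psiC_bound (c d N : nat) : Prop :=
  forall n, (0 < n)%N -> (forall q, prime q -> q %| n -> (q <= N)%N) ->
  (c * n ^ 2 <= d * psiC n)%N.

Lemma psiC_bound1 : psiC_bound 1 1 1.
Proof.
move=> n n_gt0 le1; suff ->: n = 1%N by rewrite psiC1.
apply/eqP; rewrite eqn_leq n_gt0 andbT leqNgt; apply/negP => /pdivP[q q_pr /(le1 q q_pr)].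
by rewrite leqNgt prime_gt1.
Qed.

Lemma psiC_bound_composite (c d N : nat) :
  ~~ prime N.+1 -> psiC_bound c d N -> psiC_bound c d N.+1.
Proof.
move=> npr IH n n_gt0 leN; apply: IH => // q q_pr dv_q; move: (leN q q_pr dv_q).
by rewrite leq_eqVlt => /predU1P[eq_q|//]; rewrite -eq_q q_pr in npr.
Qed.

(** For p = N + 1, the p-part u of n satisfies psi(C_u) / u^2 >= p / (p + 1) by [psiC_prime_pow],
    even when u = 1. *)
Lemma psiC_bound_prime (c d N : nat) : prime N.+1 ->
  psiC_bound c d N -> psiC_bound (c * N.+1) (d * N.+2) N.+1.
Proof.
move=> p_pr IH n n_gt0 leN; rewrite -(partnC N.+1 n_gt0).
have co: coprime (n`_(N.+1))%N (n`_(N.+1)^')%N by apply: coprime_partC.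
rewrite psiC_mul ?part_gt0 //.
have := IH _ (part_gt0 (N.+1)^' n); set m := (n`_(N.+1)^')%N => IHm.
have {}IHm: (c * m ^ 2 <= d * psiC m)%N.
  apply: IHm => q q_pr dv_qm.
  have := leN q q_pr (dvdn_trans dv_qm (dvdn_part _ _)).
  rewrite leq_eqVlt => /predU1P[eq_q|//].
  by have := pnatP _ (part_gt0 _ _) (part_pnat _ _) q q_pr dv_qm; rewrite eq_q !inE eqxx.
rewrite p_part; have := psiC_prime_pow (logn N.+1 n) p_pr.
rewrite expnS -addnn expnD; set u := (_ ^ logn _ _)%N; set v := psiC u => eq_v.
have le_v: (N.+1 * (u * u) <= N.+2 * v)%N by rewrite eq_v leq_addr.
have := leq_mul IHm le_v; nia.
Qed.

(** Here 2/3 * 3/4 = 1/2; the prime 5 then gives 1/2 * 5/6 = 5/12. *)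
Lemma psiC_bound3 : psiC_bound 1 2 3.
Proof.
move=> n n0 le_n.
have := psiC_bound_prime (isT : prime 3) (psiC_bound_prime (isT : prime 2) psiC_bound1).
by move/(_ n n0 le_n); lia.
Qed.

Lemma psiC_bound5 : psiC_bound 5 12 5.
Proof.
have b4 : psiC_bound 1 2 4 by apply: psiC_bound_composite psiC_bound3.
move=> n n0 le_n; have := psiC_bound_prime (isT : prime 5) b4 n0 le_n; lia.
Qed.

(* For N = 7 this is psi(C_n) / n^2 >= 1/2 * 5/6 * 7/8 = 35/96; each later prime
   q = 2k + 1 multiplies the bound by q / (q + 1) >= k / (k + 1). *)
Lemma psiC_bound7 (N : nat) : (7 <= N)%N -> psiC_bound 35 (24 * N.+1./2) N.
Proof.
elim: N => // N IHN; rewrite leq_eqVlt => /predU1P[<-|le7N].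
  have b6 : psiC_bound 5 12 6 by apply: psiC_bound_composite psiC_bound5.
  move=> n n0 le_n; have := psiC_bound_prime (isT : prime 7) b6 n0 le_n.
  by rewrite /=; lia.
have {}IHN := IHN le7N; have [p_pr|np] := boolP (prime N.+1); last first.
  move=> n n0 le_n; have := psiC_bound_composite np IHN n0 le_n.
  by move/leq_trans; apply; rewrite leq_mul2r leq_mul2l half_leq ?orbT.
have oddN: odd N.+1 by case/even_prime: p_pr => // e; rewrite e in le7N.
move=> n n0 le_n; have := psiC_bound_prime p_pr IHN n0 le_n.
have [k eN]: exists k, N = k.*2 by by exists N./2; lia.
rewrite eN -doubleS !doubleK /= uphalf_double; move: (n ^ 2)%N (psiC n) => s t.
nia.
Qed.

Lemma max_order_psi (gT : finGroupType) (G : {group gT}) :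
  exists2 x, x \in G & (psi G <= #[x] * #|G|)%N.
Proof.
case: (@arg_maxnP _ 1 (mem G) (fun x => #[x]) (group1 G)) => x Gx max_x.
exists x => //; rewrite mulnC -sum_nat_const; exact: leq_sum.
Qed.

(** Divide c/d n^2 <= psi(C_n) <= 77/31 psi(G) <= 77/31 |H| n by |H| n. *)
Lemma index_bound (gT : finGroupType) (G H : {group gT}) (c d N : nat) :
  psiC_bound c d N -> (forall q, prime q -> q %| #|G| -> (q <= N)%N) ->
  H \subset G -> (psi G <= #|H| * #|G|)%N -> (31 * psiC #|G| <= 77 * psi G)%N ->
  (31 * c * #|G : H| <= 77 * d)%N.
Proof.
move=> /(_ _ (cardG_gt0 G)) bnd /bnd{}bnd sHG le_psi ge_psi.
have := Lagrange sHG; have := cardG_gt0 G; have := cardG_gt0 H.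
move: #|H| #|G| #|G : H| bnd le_psi ge_psi => h n j.
move: (psi G) (psiC n) => s t; rewrite -mulnn => bnd le_psi ge_psi h0 n0 def_n.
have le1: (31 * c * (n * n) <= 77 * d * (h * n))%N by nia.
have: (31 * c * j * (h * n) <= 77 * d * (h * n))%N by rewrite -{2}def_n in le1; nia.
by rewrite leq_pmul2r // muln_gt0 h0.
Qed.

(** An index below p is prime to p, so a Sylow p-subgroup of H is one of G. The abelian group H
    normalises it, so [Sylow_normal_index] applies. *)
Lemma cyclic_small_index_Sylow (p : nat) (gT : finGroupType) (G H P : {group gT}) :
  prime p -> p.-Sylow(G) P -> H \subset G -> cyclic H -> (#|G : H| < p)%N ->
  P <| G /\ cyclic P.
Proof.
move=> p_pr sylP sHG cycH lt_p.
have [Q sylQ] := Sylow_exists p H.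
have sylQG: p.-Sylow(G) Q.
  rewrite pHallE (subset_trans (pHall_sub sylQ)) //= (card_Hall sylQ).
  rewrite -(Lagrange sHG) partnM ?cardG_gt0 ?indexg_gt0 //.
  by rewrite (part_p'nat (n := #|G : H|)) ?muln1 // p'natE // gtnNdvd.
have nsQ: Q <| G.
  apply: (Sylow_normal_index p_pr sylQG); apply: leq_ltn_trans lt_p.
  rewrite dvdn_leq ?indexg_gt0 // indexgS // subsetI sHG.
  rewrite cents_norm // centsC.
  exact: subset_trans (pHall_sub sylQ) (cyclic_abelian cycH).
have [x Gx ->] := Sylow_trans sylQG sylP.
rewrite (normP _) ?(subsetP (normal_norm nsQ)) //.
by split=> //; apply: cyclicS cycH; apply: pHall_sub sylQ.
Qed.

(** * Recognition of the alternating group of degree 4 *)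

Lemma odd_perm_order3 (T : finType) (s : {perm T}) : s ^+ 3 = 1 -> odd_perm s = false.
Proof.
move=> s3; have ->: s = (s * s) * (s * s).
  by rewrite -[LHS]mul1g -s3 !expgS expg0 mulg1 !mulgA.
by rewrite !odd_permM addbb.
Qed.

(** G acts on the four right cosets of H, faithfully because H meets some conjugate trivially.
    Elements of the conjugates of H have order dividing 3, hence act evenly. *)
Lemma isog_Alt4 (gT : finGroupType) (G H : {group gT}) :
  #|G| = 12 -> #|H| = 3 -> normedTI H^# G H -> G \isog 'Alt_('I_4).
Proof.
move=> oG oH tiH; have /normedTI_P[_ sHN tiHG] := tiH.
have sHG: H \subset G := subset_trans sHN (subsetIl _ _).
have iGH: #|G : H| = 4 by apply/eqP; rewrite -(eqn_pmul2l (cardG_gt0 H)) Lagrange // oG oH.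
have [g Gg nHg]: exists2 g, g \in G & g \notin H.
  by apply/subsetPn; apply: contraL (eqxx 3) => /subset_leq_card; rewrite oG oH.
have tiHg: H :&: H :^ g = 1.
  apply/trivgP/subsetP=> x /setIP[Hx Hgx]; apply: contraR nHg => ntx.
  apply: (tiHG g Gg); apply/pred0Pn; exists x; rewrite /= conjD1g !inE Hx Hgx.
  by rewrite inE in ntx; rewrite ntx.
pose e (i : 'I_4) : {set gT} := enum_val (cast_ord (esym iGH) i).
have Se i : e i \in rcosets H G by apply: enum_valP.
have inj_e : injective e by move=> i j /enum_val_inj/cast_ord_inj.
have surj_e X : X \in rcosets H G -> exists i, e i = X.
  move=> SX; exists (cast_ord iGH (enum_rank_in SX X)).
  by rewrite /e cast_ordK enum_rankK_in.
have Sg i x : x \in G -> exists j, e j = e i :* x.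
  move=> Gx; apply: surj_e; have /rcosetsP[y Gy ->] := Se i.
  by rewrite -rcosetM mem_rcosets (subsetP (mulG_subr H G)) // groupM.
(* The defaults make [F] and [f] total; by [FE] and [fE] they give the coset action on G. *)
pose F x i := odflt i [pick j | e j == e i :* x].
have FE x i : x \in G -> e (F x i) = e i :* x.
  move=> Gx; rewrite /F; case: pickP => [j /eqP//|/= no_j].
  by have [j /eqP] := Sg i x Gx; rewrite no_j.
have injF x : x \in G -> injective (F x).
  move=> Gx i j /(congr1 e); rewrite !FE // => eq_ij; apply: inj_e.
  by rewrite -[e i](rcosetK x) eq_ij rcosetK.
pose f x : {perm 'I_4} := if @injectiveP _ _ (F x) is ReflectT h then perm h else 1.
have fE x i : x \in G -> f x i = F x i.
  move=> Gx; rewrite /f; case: injectiveP => [h|[]]; first by rewrite permE.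
  exact: injF.
have fM : {in G &, {morph f : x y / x * y}}.
  move=> x y Gx Gy; apply/permP=> i; rewrite permM !fE ?groupM //.
  by apply: inj_e; rewrite !FE ?groupM // rcosetM.
pose fm := Morphism fM.
have inj_f : 'injm fm.
  apply/subsetP=> x /morphpreP[Gx /set1P/= fx1].
  have fix_x i : e i :* x = e i by rewrite -FE // -fE // fx1 perm1.
  have fixH y : y \in G -> H :* y :* x = H :* y.
    by move=> Gy; have [|i <-] := surj_e (H :* y); rewrite // mem_rcosets (subsetP (mulG_subr H G)).
  rewrite -tiHg inE -{1}(rcoset1 H) -(fixH 1) // rcoset1 rcoset_refl /=.
  by rewrite mem_conjg /conjg invgK mulgA -mem_rcoset -{1}(fixH g) // -rcosetM rcoset_refl.
have oA : #|'Alt_('I_4)| = 12.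
  by apply: double_inj; rewrite -mul2n card_Alt card_ord.
have sJA y : y \in G -> H :^ y \subset fm @*^-1 'Alt_('I_4).
  move=> Gy; apply/subsetP=> x Hyx.
  have Gx: x \in G by apply: subsetP Hyx; rewrite -(conjGid Gy) conjSg.
  have: #[x] %| 3 by rewrite -oH -(cardJg H y); apply: order_dvdG.
  rewrite order_dvdn => /eqP x3; have := morphX fm 3 Gx; rewrite x3 morph1.
  by move/esym/odd_perm_order3=> even_x; rewrite !inE Gx /=; apply/eqP.
have sHHM : H * H :^ g \subset fm @*^-1 'Alt_('I_4).
  by rewrite mul_subG ?sJA // -{1}(conjsg1 H) sJA.
(* The preimage contains the 3 * 3 elements of [H * H :^ g], and a divisor of 12 that is at least 9
   is 12. *)
have defM: fm @*^-1 'Alt_('I_4) = G.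
  apply/eqP; rewrite eqEcard subsetIl /= oG.
  have sMG : (fm @*^-1 'Alt_('I_4))%G \subset G by apply: subsetIl.
  have := Lagrange sMG; have := subset_leq_card sHHM.
  rewrite card_mulg_conj tiHg indexg1 oH /= oG; move: #|_| #|_ : _|; clear => m [|[|i]]; lia.
have <-: fm @* G = 'Alt_('I_4).
  apply/eqP; rewrite eqEcard oA card_injm // oG leqnn andbT.
  by rewrite sub_morphim_pre // defM.
exact: sub_isog.
Qed.

(** * Structure of G over a cyclic subgroup of index 4 *)

Section Index4.

Variables (gT : finGroupType) (G H : {group gT}).
Hypotheses (sHG : H \subset G) (cycH : cyclic H) (iGH : #|G : H| = 4).
Hypothesis primes_G : forall q, prime q -> q %| #|G| -> (q <= 3)%N.
Hypothesis nssG : ~ supersolvable G.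

(** As 4 is prime to 3, P is also a Sylow subgroup of G. The number of its conjugates divides 4, is
    1 modulo 3, and is not 1; so it is 4. *)
Lemma norm_Sylow3_index4 (P : {group gT}) : 3.-Sylow(H) P -> 'N_G(P) = H.
Proof.
move=> sylP; have sPH := pHall_sub sylP; have sPG := subset_trans sPH sHG.
have sylPG: 3.-Sylow(G) P.
  rewrite pHallE sPG /= (card_Hall sylP) -(Lagrange sHG) iGH.
  by rewrite partnM ?cardG_gt0 // (part_p'nat (n := 4)) ?muln1.
have sHN: H \subset 'N_G(P).
  rewrite subsetI sHG cents_norm // centsC.
  exact: subset_trans sPH (cyclic_abelian cycH).
(* For P normal, G / P would be a 2-group and G supersolvable. *)
have not_nsP: ~~ (P <| G).
  apply/negP=> nsP; apply: nssG.
  apply: (supersolvable_quotient_cyclic nsP (cyclicS sPH cycH)).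
  apply: (@supersolvable_pgroup 2); rewrite /pgroup card_quotient ?normal_norm //=.
  apply/pnatP=> // q q_pr dv_q; have dv_qG := dvdn_trans dv_q (dvdn_indexg _ _).
  have := primes_G q_pr dv_qG; have := prime_gt1 q_pr.
  have : 3^'.-nat #|G : P| by case/and3P: sylPG.
  move/pnatP => /(_ (indexg_gt0 _ _) q q_pr dv_q).
  by rewrite !inE; case: q {q_pr dv_q dv_qG} => [|[|[|[|]]]].
have := card_Syl_mod G (isT : prime 3); rewrite (card_Syl sylPG).
have := indexgS G sHN; rewrite iGH => dv4.
have : #|G : 'N_G(P)| != 1%N.
  by apply: contra not_nsP; rewrite indexg_eq1 subsetI subxx /normal sPG.
have /dvdn_leq : #|G : 'N_G(P)| %| 4 by []; move=> /(_ isT).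
have := Lagrange_index (subsetIl G 'N(P)) sHN; rewrite iGH.
case: #|G : _| dv4 => [|[|[|[|[|]]]]] //= _ /eqP.
rewrite -{2}[4]muln1 eqn_pmul2l // indexg_eq1 => sNH _ _ _.
by apply/eqP; rewrite eqEsubset sNH.
Qed.

(** Counting [H * H :^ g] inside G bounds the index by 4. Were it prime to 3, P would lie in the
    cyclic group [H :^ g], so P would equal its conjugate by g and g would lie in ['N_G(P)], which
    is H. *)
Lemma index4_conjI (g : gT) : g \in G -> g \notin H -> #|H : H :&: H :^ g| = 3.
Proof.
move=> Gg nHg; have [P sylP] := Sylow_exists 3 H.
have sPH := pHall_sub sylP; have NP := norm_Sylow3_index4 sylP.
have sHgG: H :^ g \subset G by rewrite -(conjGid Gg) conjSg.
set j := #|_ : _|.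
have le_j4: (j <= 4)%N.
  rewrite -(leq_pmul2l (cardG_gt0 H)) -card_mulg_conj -[X in (_ <= _ * X)%N]iGH.
  by rewrite Lagrange // subset_leq_card ?mul_subG.
have dv3j: 3 %| j.
  apply: contraR nHg; rewrite -(p'natE _ (isT : prime 3)) => p'j.
  have dvPD: #|P| %| #|H :&: H :^ g|.
    rewrite (card_Hall sylP) -(Lagrange (subsetIl H (H :^ g))).
    by rewrite partnM ?cardG_gt0 // (part_p'nat p'j) muln1 dvdn_part.
  have sPHg: P \subset H :^ g.
    have : P \subset H :&: H :^ g.
      by rewrite -(cardSg_cyclic cycH) ?subsetIl.
    by move/subset_trans; apply; apply: subsetIr.
  have cycHg: cyclic (H :^ g) by rewrite cyclicJ.
  have /eqP defP : P :==: P :^ g.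
    by rewrite (eq_subG_cyclic (K := (P :^ g)%G) cycHg) ?conjSg //= cardJg.
  by rewrite -NP; apply/setIP; split=> //; apply/normP.
have: (0 < j)%N := indexg_gt0 _ _.
by move: j le_j4 dv3j => [|[|[|[|[|]]]]].
Qed.

(** A cyclic group has only one subgroup of index 3, so the intersection of H with a conjugate does
    not depend on the conjugating element outside H. *)
Lemma index4_structure : exists K : {group gT},
  [/\ K \subset H, #|H : K| = 3, G \subset 'C(K) & normedTI (H :\: K) G H].
Proof.
have [g Gg nHg]: exists2 g, g \in G & g \notin H.
  by apply/subsetPn; rewrite -indexg_eq1 iGH.
have sHgG: H :^ g \subset G by rewrite -(conjGid Gg) conjSg.
pose K := (H :&: H :^ g)%G; have iHK : #|H : K| = 3 by apply: index4_conjI.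
have sKH: K \subset H by apply: subsetIl.
have sKG: K \subset G := subset_trans sKH sHG.
have sHHC: H * H :^ g \subset 'C_G(K).
  by rewrite subsetI mul_subG ?cyclic_conjI_cent.
have cKG: G \subset 'C(K).
  have sCG: 'C_G(K) \subset G := subsetIl _ _.
  (* The order of this centraliser divides 4 |H| and is at least 3 |H|. *)
  apply/setIidPl/eqP; rewrite eqEsubset sCG -indexg_eq1.
  have := Lagrange sCG; rewrite -(Lagrange sHG) iGH.
  have := subset_leq_card sHHC; rewrite card_mulg_conj -/K iHK.
  have := cardG_gt0 H.
  by move: #|H| #|'C_G(K)| #|_ : _|; clear => h c [|[|i]]; nia.
exists K; split=> //; apply/normedTI_P; split.
- by rewrite setD_eq0 -indexg_eq1 iHK.
- rewrite subsetI sHG; apply/subsetP=> h Hh; apply/normP.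
  rewrite conjDg conjGid // (normP _) //.
  by rewrite (subsetP (cents_norm cKG)) // (subsetP sHG).
move=> x Gx /pred0Pn[y /andP[/= /setDP[Hy nKy]]]; rewrite conjDg => /setDP[Hxy _].
apply: contraR nKy => nHx; have iHx := index4_conjI Gx nHx.
suff /eqP<-: (H :&: H :^ x)%G :==: K by rewrite inE Hy.
rewrite (eq_subG_cyclic cycH) ?subsetIl //.
rewrite -(eqn_pmul2r (isT : 0 < 3)%N) -{1}iHx -iHK.
by rewrite !Lagrange ?subsetIl.
Qed.

End Index4.

(** * Estimate of psi(G) in the index 4 case *)

(** An element of H conjugate into V has order dividing gcd(|H|, |V|) = |K|, which in the cyclic
    group H puts it in K. *)
Lemma disjoint_class_support_coprime (gT : finGroupType) (G H K V : {group gT}) :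
  cyclic H -> K \subset H -> K \subset V -> coprime #|H : K| #|V : K| ->
  [disjoint V & class_support (H :\: K) G].
Proof.
move=> cycH sKH sKV co_idx.
apply/pred0Pn=> -[y /andP[/= Vy /imset2P[z x /setDP[Hz nKz] Gx def_y]]].
case/negP: nKz; rewrite -cycle_subG -(cardSg_cyclic cycH) ?cycle_subG //.
have ozV: #|<[z]>| %| #|V| by rewrite -orderE -(orderJ z x) -def_y order_dvdG.
have ozH: #|<[z]>| %| #|H| by rewrite -orderE order_dvdG.
have: #|<[z]>| %| gcdn #|H| #|V| by rewrite dvdn_gcd ozH.
rewrite -(Lagrange sKH) -(Lagrange sKV) -muln_gcdr.
by move: co_idx; rewrite /coprime => /eqP->; rewrite muln1.
Qed.

(* Elements outside K have order at most #|Q| / 2 = 2d. *)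
Lemma psi_noncyclic_2group (gT : finGroupType) (Q K : {group gT}) (d : nat) :
  2.-group Q -> ~~ cyclic Q -> K \subset Q -> cyclic K -> #|K| = d ->
  #|Q| = (4 * d)%N -> (psi Q <= psiC d + 6 * d ^ 2)%N.
Proof.
move=> pQ ncQ sKQ cycK oK oQ; rewrite /psi (big_setID K) /= (setIidPr sKQ).
rewrite -[\sum_(i in K) _]/(psi K) (psi_cyclic cycK) oK leq_add2l.
have ->: (6 * d ^ 2 = #|Q :\: K| * (2 * d))%N.
  by rewrite cardsD (setIidPr sKQ) oK oQ; nia.
rewrite -sum_nat_const; apply: leq_sum => y /setDP[Qy _].
have [m o2] := p_natP pQ; have := order_dvdG Qy; rewrite o2.
case/(dvdn_pfactor _ _ (isT : prime 2)) => i; rewrite leq_eqVlt.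
case/predU1P=> [-> oy|lt_im ->].
  case/negP: ncQ; apply/cyclicP; exists y; apply/esym/eqP.
  by rewrite eqEcard cycle_subG Qy -orderE oy o2 leqnn.
rewrite -(leq_pmul2l (isT : 0 < 2)%N) mulnA -[(2 * 2)%N]/4 -oQ o2.
by rewrite -expnS leq_pexp2l.
Qed.

Lemma sum_order_class_support (gT : finGroupType) (G H K : {group gT}) :
  normedTI (H :\: K) G H -> cyclic H -> K \subset H ->
  (\sum_(x in class_support (H :\: K) G) #[x] =
     #|G : H| * (psiC #|H| - psiC #|K|))%N.
Proof.
move=> tiHK cycH sKH; have partHK := partition_normedTI tiHK.
rewrite (set_partition_big _ partHK) /=.
have /and3P[_ _ /eqP NH] := tiHK.
have <-: #|(H :\: K) :^: G| = #|G : H| by rewrite card_conjugates NH.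
rewrite -sum_nat_const; apply: eq_bigr => _ /imsetP[x Gx ->].
rewrite big_imset /=; last by move=> y z _ _ /conjg_inj.
under eq_bigr do rewrite orderJ.
rewrite -(psi_cyclic cycH) -(psi_cyclic (cyclicS sKH cycH)) /psi.
by rewrite [in RHS](big_setID K) /= (setIidPr sKH) addKn.
Qed.

Section PsiIndex4.

Variables (gT : finGroupType) (G H K : {group gT}).
Hypotheses (sHG : H \subset G) (cycH : cyclic H) (iGH : #|G : H| = 4).
Hypothesis primes_G : forall q, prime q -> q %| #|G| -> (q <= 3)%N.
Hypothesis nssG : ~ supersolvable G.
Hypotheses (sKH : K \subset H) (iHK : #|H : K| = 3) (cKG : G \subset 'C(K)).
Hypothesis tiHK : normedTI (H :\: K) G H.

(** The first product bounds psi of V = Q x K_3; the second term comes from the four conjugates of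
    [H :\: K]. *)
Lemma psi_index4_bound : exists i j,
  [/\ #|K| = (2 ^ i * 3 ^ j)%N, #|G| = (2 ^ i.+2 * 3 ^ j.+1)%N &
    (psi G <= (psiC (2 ^ i) + 6 * (2 ^ i) ^ 2) * psiC (3 ^ j)
              + 4 * (psiC (2 ^ i) * (psiC (3 ^ j.+1) - psiC (3 ^ j))))%N].
Proof.
have sKG := subset_trans sKH sHG; have cycK := cyclicS sKH cycH.
have oH: #|H| = (3 * #|K|)%N by rewrite -(Lagrange sKH) iHK mulnC.
have oG: #|G| = (12 * #|K|)%N by rewrite -(Lagrange sHG) iGH oH mulnAC.
have nilK := abelian_nil (cyclic_abelian cycK).
have hall2 := nilpotent_pcore_Hall 2 nilK.
have hall2' := nilpotent_pcore_Hall 2^' nilK.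
set K2 := 'O_2(K)%G in hall2; set K3 := ('O_2^'(K))%G in hall2'.
have [sK2 sK3]: K2 \subset K /\ K3 \subset K by rewrite !pcore_sub.
have [i o2] := p_natP (pHall_pgroup hall2).
have [j o3]: {j | #|K3| = (3 ^ j)%N}.
  apply: p_natP; apply/pnatP=> // q q_pr dv_q.
  have dv_qG: q %| #|G|.
    exact: dvdn_trans dv_q (cardSg (subset_trans sK3 sKG)).
  have := primes_G q_pr dv_qG; have := prime_gt1 q_pr.
  have /pnatP := pHall_pgroup hall2'; move=> /(_ (cardG_gt0 _) q q_pr dv_q).
  by rewrite !inE; case: q {q_pr dv_q dv_qG} => [|[|[|[|]]]].
have oK: #|K| = (2 ^ i * 3 ^ j)%N.
  by rewrite -o2 -o3 (card_Hall hall2) (card_Hall hall2') partnC.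
have [Q sylQ] := Sylow_exists 2 G.
have sQG := pHall_sub sylQ; have pQ := pHall_pgroup sylQ.
have oQ: #|Q| = (4 * 2 ^ i)%N.
  rewrite (card_Hall sylQ) oG -o2 (card_Hall hall2).
  have p12: (12`_2)%N = 4 by rewrite p_part.
  by rewrite partnM ?cardG_gt0 // p12.
have co23: coprime (4 * 2 ^ i) (3 ^ j) by rewrite -[4]/(2 ^ 2)%N -expnD coprimeXl ?coprimeXr.
have cQK3: K3 \subset 'C(Q).
  by rewrite (subset_trans sK3) // centsC (subset_trans sQG).
have tiQK3: Q :&: K3 = 1 by rewrite coprime_TIg // oQ o3.
have defV := dprodE cQK3 tiQK3; rewrite -(cent_joinEr cQK3) in defV.
set V := (Q <*> K3)%G in defV.
have oV: #|V| = (4 * #|K|)%N.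
  by rewrite -(dprod_card defV) oQ o3 oK mulnA.
have sVG: V \subset G by rewrite join_subG sQG (subset_trans sK3).
(* Some conjugate of [K2] lies in Q, and [K2] is central in G. *)
have sK2Q: K2 \subset Q.
  have [x Gx] := Sylow_Jsub sylQ (subset_trans sK2 sKG) (pHall_pgroup hall2).
  have cGK2: G \subset 'C(K2) := subset_trans cKG (centS sK2).
  by rewrite (normP _) // (subsetP (cents_norm cGK2)).
have sKV: K \subset V.
  rewrite -(dprodW (nilpotent_pcoreC 2 nilK)) mul_subG //=.
    exact: subset_trans sK2Q (joing_subl _ _).
  exact: joing_subr.
have iVK: #|V : K| = 4.
  by apply/eqP; rewrite -(eqn_pmul2l (cardG_gt0 K)) Lagrange // oV mulnC.
have disjV : [disjoint V & class_support (H :\: K) G].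
  by apply: disjoint_class_support_coprime; rewrite ?iHK ?iVK.
have oHK: #|H :\: K| = (2 * #|K|)%N.
  by rewrite cardsD (setIidPr sKH) oH -{2}[#|K|]mul1n -mulnBl.
(* V misses every conjugate of H :\: K, and 4 * 2#|K| = #|G| - #|V|. *)
have defG: G :\: V = class_support (H :\: K) G.
  apply/eqP; rewrite eq_sym eqEcard; apply/andP; split.
    rewrite subsetD class_support_subG ?(subset_trans (subsetDl _ _)) //=.
    by rewrite disjoint_sym.
  by rewrite (card_support_normedTI tiHK) oHK cardsD (setIidPr sVG) iGH oG oV
    -mulnBl mulnAC.
(* A cyclic Q would make V cyclic of prime index 3. *)
have ncQ: ~~ cyclic Q.
  apply/negP=> cycQ; apply: nssG.
  apply: (@supersolvable_cyclic_prime_index _ _ V) => //.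
    by rewrite (cyclic_dprod defV) ?oQ ?o3 // (cyclicS sK3).
  have -> : #|G : V| = 3; last by [].
  by apply/eqP; rewrite -(eqn_pmul2l (cardG_gt0 V)) Lagrange // oG oV mulnAC.
exists i, j; split=> //; first by rewrite oG oK !expnS mulnACA !mulnA.
have ->: psi G = (psi V + \sum_(x in G :\: V) #[x])%N.
  by rewrite {1}/psi (big_setID V) /= (setIidPr sVG).
rewrite defG (sum_order_class_support tiHK cycH sKH) iGH oH oK.
have -> : (3 * (2 ^ i * 3 ^ j) = 2 ^ i * 3 ^ j.+1)%N by rewrite expnS mulnCA.
have co m n : coprime (2 ^ m) (3 ^ n) by rewrite coprimeXl ?coprimeXr.
rewrite !psiC_mul ?expn_gt0 // -mulnBr leq_add2r.
rewrite (psi_dprod defV) ?oQ ?o3 // (psi_cyclic (cyclicS sK3 cycK)) o3.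
by rewrite leq_mul2r (psi_noncyclic_2group pQ ncQ sK2Q (cyclicS sK2 cycK) o2 oQ) orbT.
Qed.

Lemma psi_index4 : (31 * psiC #|G| <= 77 * psi G)%N ->
  (77 * psi G = 31 * psiC #|G|)%N /\ #|K| = 1%N.
Proof.
have [i [j [-> -> le_psi]]] := psi_index4_bound.
have co m n : coprime (2 ^ m) (3 ^ n) by rewrite coprimeXl ?coprimeXr.
rewrite psiC_mul ?expn_gt0 //.
have := psiC_prime_pow i (isT : prime 2); have := psiC_prime_pow i.+2 (isT : prime 2).
have := psiC_prime_pow j (isT : prime 3); have := psiC_prime_pow j.+1 (isT : prime 3).
have := psiC_primeS j (isT : prime 3).
rewrite !doubleS -!addnn !expnS !expnD ?expn0 ?muln1.
have: (0 < 2 ^ i)%N by rewrite expn_gt0.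
have: (0 < 3 ^ j)%N by rewrite expn_gt0.
move: le_psi; rewrite !expnS ?expn0 ?muln1.
move: (2 ^ i)%N (3 ^ j)%N => d e.
move: (psiC (2 * (2 * d)))%N (psiC (3 * e))%N (psiC d) (psiC e) (psi G) => w v u t s.
clear; move=> le_s e_gt0 d_gt0 _ ev et ew eu ge_s.
(* The bounds combine to 7380 DE <= 548 D + 6786 E + 46 with D = d^2, E = e^2. *)
have [d1 def_D]: exists d1, (d * d = d1.+1)%N.
  by exists (d * d).-1; rewrite prednK // muln_gt0 d_gt0.
have [e1 def_E]: exists e1, (e * e = e1.+1)%N.
  by exists (e * e).-1; rewrite prednK // muln_gt0 e_gt0.
have dv1 m : (m * m = 1 -> m = 1)%N by case: m => [|[|m]].
suff [d10 e10 s_eq]: [/\ d1 = 0%N, e1 = 0%N & (77 * s = 31 * (w * v))%N].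
  by rewrite d10 in def_D; rewrite e10 in def_E; rewrite (dv1 d) // (dv1 e).
rewrite {}def_E {}def_D {d e d_gt0 e_gt0} in le_s ev et ew eu *.
have vt: (v - t = 6 * e1.+1)%N by lia.
rewrite vt in le_s.
(* The factor 12 = 3 * 4 clears the denominators p + 1 for p = 2 and p = 3. *)
have le12: (12 * s <= (3 * u + 18 * d1.+1) * (4 * t) + 96 * (3 * u * e1.+1))%N by lia.
have ge12: (31 * (3 * w * (4 * v)) <= 77 * (12 * s))%N by lia.
have eq12: (12 * (w * v) = 3 * w * (4 * v))%N by lia.
rewrite {}et {}eu in le12; rewrite ev ew in ge12 eq12.
have le12x : ((2 * d1.+1 + 1 + 18 * d1.+1) * (3 * e1.+1 + 1) +
    96 * ((2 * d1.+1 + 1) * e1.+1) =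
    252 * (d1 * e1) + 272 * d1 + 351 * e1 + 372)%N by clear; lia.
have ge12x : ((2 * (2 * (2 * (2 * (2 * d1.+1)))) + 1) * (3 * (3 * (3 * e1.+1)) + 1) =
    864 * (d1 * e1) + 896 * d1 + 891 * e1 + 924)%N by clear; lia.
rewrite {}le12x in le12; rewrite {}ge12x in ge12 eq12.
(* Since 77 * 372 = 31 * 924 the constants cancel, leaving 7380 X + 6832 d1 + 594 e1 <= 0. *)
have d10: d1 = 0%N by move: (12 * s)%N (d1 * e1)%N le12 ge12 => S X; clear; lia.
have e10: e1 = 0%N by move: (12 * s)%N (d1 * e1)%N le12 ge12 => S X; clear; lia.
by split=> //; move: le12 ge12 eq12; rewrite d10 e10; lia.
Qed.

End PsiIndex4.

(** * Induction on the order and conclusion *)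

Definition A4_times_cyclic (gT : finGroupType) (G : {group gT}) : Prop :=
  exists A C : {group gT},
    [/\ A \x C = G, A \isog 'Alt_('I_4), cyclic C & coprime 6 #|C|].

Lemma psi_gt0 (gT : finGroupType) (G : {group gT}) : (0 < psi G)%N.
Proof. by rewrite /psi (bigD1 1) //= order1. Qed.

(** A Schur-Zassenhaus complement L of the central P is a direct factor isomorphic to G / P. P joins
    the cyclic factor, its order being prime to |L| = 12 |C|. *)
Lemma A4_times_cyclic_central_Sylow (p : nat) (gT : finGroupType) (G P : {group gT}) :
  p.-Sylow(G) P -> P <| G -> cyclic P -> G \subset 'C(P) ->
  A4_times_cyclic (G / P)%G -> A4_times_cyclic G.
Proof.
move=> sylP nsPG cycP cPG [A [C [defGP isoA cycC co6C]]].
have /splitsP[L /complP[tiPL defG]] := SchurZassenhaus_split (pHall_Hall sylP) nsPG.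
have sLG: L \subset G by rewrite -defG mulG_subr.
have cPL: L \subset 'C(P) := subset_trans sLG cPG.
have isoL: (G / P)%G \isog L.
  rewrite isog_sym /= -defG quotientMidl.
  exact: quotient_isog (cents_norm cPL) tiPL.
have [f inj_f im_f] := isogP isoL.
have [_ defM _ _] := dprodP defGP.
have sA: A \subset G / P by rewrite -defM mulG_subl.
have sC: C \subset G / P by rewrite -defM mulG_subr.
have defL := injm_dprod (subxx _) inj_f defGP; rewrite im_f in defL.
have defPL : P \x L = G by rewrite dprodE.
have coPL: coprime #|P| #|L|.
  rewrite -(card_isog isoL) /= card_quotient ?normal_norm //.
  by case/andP: (pHall_Hall sylP).
have oL: #|L| = (12 * #|C|)%N.
  rewrite -(card_isog isoL) -(dprod_card defGP) (card_isog isoA); congr (_ * _)%N.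
  by apply: double_inj; rewrite -mul2n card_Alt card_ord.
rewrite oL coprimeMr in coPL; have [coP12 coPC] := andP coPL.
have coP6: coprime #|P| 6 by apply: coprime_dvdr coP12.
rewrite -defL dprodA dprodC dprodA dprodC in defPL.
have [[_ D _ defD] _ _ _] := dprodP defPL.
exists (f @* A)%G, D; split.
- by rewrite -defD.
- by rewrite -(isog_transl _ (sub_isog sA inj_f)).
- have coD : coprime #|f @* C| #|P| by rewrite card_injm // coprime_sym.
  by rewrite (cyclic_dprod defD) ?morphim_cyclic.
by rewrite -(dprod_card defD) card_injm // coprimeMr co6C coprime_sym.
Qed.

(** An inequality is assumed because only that passes from G to G / P. The equality obtained for G /
    P then forces equality for G and makes P central. *)
Lemma psi_extremal (gT : finGroupType) (G : {group gT}) :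
  ~ supersolvable G -> (31 * psiC #|G| <= 77 * psi G)%N ->
  (77 * psi G = 31 * psiC #|G|)%N /\ A4_times_cyclic G.
Proof.
have [n] := ubnP #|G|; elim: n gT G => // n IHn gT G leGn nssG ge_psi.
have reduce (p : nat) (P : {group gT}) : prime p -> p %| #|G| -> p.-Sylow(G) P ->
    P <| G -> cyclic P -> (77 * psi G = 31 * psiC #|G|)%N /\ A4_times_cyclic G.
  move=> p_pr dv_p sylP nsPG cycP.
  have oG: #|G| = (#|P| * #|G / P|)%N.
    by rewrite card_quotient ?normal_norm // Lagrange ?normal_sub.
  have co: coprime #|P| #|G / P|.
    by rewrite card_quotient ?normal_norm //; case/andP: (pHall_Hall sylP).
  have ntP: P :!=: 1.
    rewrite -cardG_gt1 (card_Hall sylP) p_part_gt1.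
    by rewrite mem_primes p_pr cardG_gt0.
  have nssGP: ~ supersolvable (G / P)%G.
    by move=> ssGP; apply: nssG; apply: supersolvable_quotient_cyclic ssGP.
  have [le_psi eq_psi] := psi_normal_cyclic_Sylow sylP nsPG cycP.
  rewrite {1}oG psiC_mul ?cardG_gt0 // -(psi_cyclic cycP) in ge_psi *.
  have P_gt0 := psi_gt0 P.
  have [||eqGP decGP] := IHn _ (G / P)%G _ nssGP.
  - by rewrite -ltnS (leq_trans _ leGn) // ltnS ltn_quotient ?normal_sub.
  - rewrite -(leq_pmul2l P_gt0) mulnCA [leqRHS]mulnCA.
    by apply: leq_trans ge_psi _; rewrite leq_mul2l.
  have eq31: (77 * (psi P * psi (G / P)) = 31 * (psi P * psiC #|G / P|))%N.
    by rewrite mulnCA eqGP mulnCA.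
  have eqG: (psi G = psi P * psi (G / P))%N.
    by apply/eqP; rewrite eqn_leq le_psi /= -(leq_pmul2l (isT : 0 < 77)%N) eq31.
  split; first by rewrite eqG eq31 [in RHS]oG psiC_mul ?cardG_gt0 // -(psi_cyclic cycP).
  apply: A4_times_cyclic_central_Sylow sylP nsPG cycP _ decGP.
  by rewrite -eq_psi eqG.
have [x Gx le_x] := max_order_psi G; pose H := <[x]>%G.
have sHG: H \subset G by rewrite cycle_subG.
have cycH: cyclic H := cycle_cyclic x.
have small p : prime p -> p %| #|G| -> (#|G : H| < p)%N ->
    (77 * psi G = 31 * psiC #|G|)%N /\ A4_times_cyclic G.
  move=> p_pr dv_p lt_p; have [P sylP] := Sylow_exists p G.
  have [nsP cycP] := cyclic_small_index_Sylow p_pr sylP sHG cycH lt_p.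
  exact: reduce sylP nsP cycP.
have not_prime: ~~ prime #|G : H|.
  by apply/negP=> pr; apply: nssG; apply: supersolvable_cyclic_prime_index pr.
have neq1: #|G : H| != 1%N.
  rewrite indexg_eq1; apply/negP=> sGH; apply: nssG.
  exact: supersolvable_cyclic (cyclicS sGH cycH).
have idx_gt0: (0 < #|G : H|)%N := indexg_gt0 _ _.
have gt1: (1 < #|G|)%N.
  rewrite cardG_gt1; apply/eqP=> G1; apply: nssG.
  by apply: supersolvable_cyclic; rewrite G1 cyclic1.
set p := max_pdiv #|G|.
have p_pr: prime p := max_pdiv_prime gt1.
have dv_p: p %| #|G| := max_pdiv_dvd _.
have le_p q : prime q -> q %| #|G| -> (q <= p)%N.
  by move=> q_pr dv_q; apply: max_pdiv_max; rewrite mem_primes q_pr cardG_gt0.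
have idx c d N (bnd : psiC_bound c d N) (leN : (p <= N)%N) :
    (31 * c * #|G : H| <= 77 * d)%N.
  apply: (index_bound bnd) => // q q_pr dv_q.
  exact: leq_trans (le_p q q_pr dv_q) leN.
have [le_p3|gt_p3] := leqP p 3.
  have le3 q : prime q -> q %| #|G| -> (q <= 3)%N.
    by move=> q_pr dv_q; apply: leq_trans (le_p q q_pr dv_q) le_p3.
  (* The bound 31 j <= 154 gives j <= 4, and only 4 is neither prime nor at most 1. *)
  have i4: #|G : H| = 4.
    have := idx _ _ _ psiC_bound3 le_p3.
    by move: #|G : H| not_prime neq1 idx_gt0 ; clear; case=> [|[|[|[|[|j]]]]] //; lia.
  have [K [sKH iHK cKG tiHK]] := index4_structure sHG cycH i4 le3 nssG.
  have [eq_psi oK] := psi_index4 sHG cycH i4 le3 nssG sKH iHK cKG tiHK ge_psi.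
  split=> //; exists G, 1%G; rewrite dprodg1 cyclic1 cards1; split=> //.
  have K1 : K :=: 1 by apply: card1_trivg.
  have oH: #|H| = 3 by rewrite -(Lagrange sKH) oK iHK.
  apply: (@isog_Alt4 _ G H) => //; first by rewrite -(Lagrange sHG) oH i4.
  by rewrite K1 in tiHK.
have [le_p5|gt_p5] := leqP p 5.
  have le5 := idx _ _ _ psiC_bound5 le_p5.
  have p5: p = 5.
    by move: p p_pr gt_p3 le_p5 {dv_p le_p idx} => [|[|[|[|[|[|]]]]]].
  apply: (small p) => //; rewrite p5.
  (* The bound 155 j <= 924 gives j <= 5, and 5 is prime. *)
  by move: #|G : H| le5 not_prime ; clear; case=> [|[|[|[|[|[|j]]]]]] //; lia.
have gt_p6: (7 <= p)%N.
  by rewrite ltn_neqAle gt_p5 andbT; apply: contraTneq p_pr => <-.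
have odd_p : odd p by case/even_prime: p_pr => // e; rewrite e in gt_p6.
have := idx _ _ _ (psiC_bound7 gt_p6) (leqnn p).
move=> le_idx; apply: (small p) => //.
(* Now 1085 j <= 924 (p + 1), which is less than 1085 p for p >= 7. *)
have e2 : (24 * p.+1./2 = 12 * p.+1)%N by lia.
by rewrite e2 in le_idx; lia.
Qed.

Theorem theorem2p2 (gT : finGroupType) (G : {group gT}) :
  ~ supersolvable G ->
  (77 * psi G = 31 * psiC #|G|)%N ->
  exists m : nat, [/\ (0 < m)%N, coprime 6 m &
    G \isog setX ('Alt_('I_4)) (Zp m)].
Proof.
move=> nssG eq_psi.
have [|_ [A [C [defG isoA cycC co6C]]]] := psi_extremal nssG.
  by rewrite eq_psi.
exists #|C|; split=> //.
apply: (isog_dprod defG (setX_dprod 'Alt_('I_4)%G (Zp_group #|C|))).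
  exact: isog_trans isoA (isog_setXg1 _ _).
apply: isog_trans (isog_setX1g _ (Zp_group #|C|)).
by rewrite isog_cyclic_card // cyclic_Zp card_Zp /=.
Qed.
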